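(* Assume a Turing instability occurs at $\mu=0$, and consider the stripes on the quasi-square domain $[0,2\pi/\kappa]\times[0,2\pi/\ell]$ ($\kappa=k_c+\tilde\kappa$, $\ell=k_c+\tilde\ell$, rescaled to $[0,2\pi]^2$) with periodic boundary conditions, scaling $(A,\alpha,\beta,\tilde\kappa,\tilde\ell)=(\varepsilon A',\varepsilon^2\alpha',\varepsilon\beta',\varepsilon\kappa',\varepsilon\ell')$, and velocity parameter $c=c(\mu)=-\lambda_\beta+\mathcal{O}(\varepsilon)$ of the stripes. Assume in addition that $Q[\cdot,\cdot]=\varepsilon Q'[\cdot,\cdot]$ with $Q'$ bounded in $\varepsilon$. Then the double eigenvalue of the matrix $L_2^{\rm sq}$ (the subblock of the linearisation in stripes defined in the context) is given by $$\lambda_{\rm sq}=\varepsilon^2\left(-\alpha'-2\rho_\beta\beta'^2+\rho_\kappa(\ell'^2-2\kappa'^2)\right)+o(\varepsilon^2).$$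
   Context: System: $u_t=D\Delta u+Lu+\check\alpha Mu+\beta Bu_x+Q[u,u]+K[u,u,u]$, $u\in\mathbb{R}^2$, $\mathbf{x}=(x,y)\in\mathbb{R}^2$; $D=\mathrm{diag}(d_1,d_2)$, $d_i>0$; $L=\begin{pmatrix}a_1&a_2\\ a_3&a_4\end{pmatrix}$ and $M$ real $2\times2$ matrices; $Q$, $K$ symmetric bilinear/trilinear on $\mathbb{R}^2$, extended multilinearly to $\mathbb{C}^2$; $B=B(c)=\mathrm{diag}(1+c,c)$ with $c\in\mathbb{R}$. Turing instability with wavenumber $k_c>0$ at $\check\alpha=\beta=0$: with $\hat{\mathcal L}(k,\ell)=-(k^2+\ell^2)D+L+\check\alpha M+\mathrm{i}k\beta B$ and $d(\lambda,k,\ell)=\det(\hat{\mathcal L}(k,\ell)-\lambda\,\mathrm{Id})$, at $\check\alpha=\beta=0$: (1) all eigenvalues of $L$ have negative real part; (2) $d=0$ and $\mathrm{Re}\,\lambda\ge0$ iff $\lambda=0$ and $k^2+\ell^2=k_c^2$; (3) $\partial_\lambda d\ne0$ there. Set $\lambda_M:=-\partial_{\check\alpha}d/\partial_\lambda d$ (at $\check\alpha=0,\lambda=0$), assumed nonzero, and $\alpha:=\lambda_M\check\alpha$. Coefficients: $E_0,E_0^*\in\mathbb{R}^2$ span the kernels of $-k_c^2D+L$ and its transpose, $\langle E_0,E_0\rangle=\langle E_0,E_0^*\rangle=1$. $(-k_c^2D+L)^{-1}$ denotes the inverse from the range to the kernel of the projection $\langle\cdot,E_0^*\rangle E_0$.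 All coefficients are evaluated at $\mu=0$, where $c=-\lambda_\beta$, $\lambda_\beta=\frac{a_4-k_c^2d_2}{a_1+a_4-k_c^2(d_1+d_2)}$, so $\langle BE_0,E_0^*\rangle=0$. Define $Q_0=-2L^{-1}Q[\overline{E_0},E_0]$, $Q_2=-2(-4k_c^2D+L)^{-1}Q[E_0,E_0]$, $q_0=\langle Q[E_0,Q_0],E_0^*\rangle$, $q_2=\langle Q[\overline{E_0},Q_2],E_0^*\rangle$, $k_0=\langle K[E_0,E_0,\overline{E_0}],E_0^*\rangle$, $\rho_{\rm nl}=3k_0+2q_0+q_2$, $w_{A\beta}=k_c(-k_c^2D+L)^{-1}(\langle BE_0,E_0^*\rangle-B)E_0$, $w_{A\kappa}=2k_c(-k_c^2D+L)^{-1}DE_0$, $\rho_\beta=-k_c\langle Bw_{A\beta},E_0^*\rangle>0$, $\rho_\kappa=-2k_c\langle Dw_{A\kappa},E_0^*\rangle<0$. Standing assumption: $\rho_{\rm nl}<0$ (so, when $Q=\varepsilon Q'$, also $k_0<0$). Scaling: as in the claim, with $0<\varepsilon\ll1$ and primed quantities bounded; $\mu=(\alpha,\beta,\tilde\kappa)$. Stripes (known existence result): nontrivial small travelling waves constant in $y$, $2\pi/\kappa$-periodic in $x$, velocity $\beta c$ with $c=c(\mu)=-\lambda_\beta+\mathcal{O}(\varepsilon)$, leading-order profile $2\varepsilon A'E_0\cos(\kappa x)$ up to translation, in 1-to-1 correspondence with solutions $A=\varepsilon A'>0$ of $\varepsilon^2(\alpha'+\rho_\beta\beta'^2+\rho_\kappa\kappa'^2+\rho_{\rm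 nl}A'^2+\mathcal{O}(\varepsilon))=0$. The matrix $L_2^{\rm sq}$: on the rescaled domain $[0,2\pi]^2$ there is a four-dimensional centre manifold with coordinates $u_c=\sum_{j=\pm1,\pm2}u_j\mathrm{e}^{\mathrm{i}\mathbf{k}_j\cdot\mathbf{x}}E_0$, $\mathbf{k}_1=(1,0)$, $\mathbf{k}_2=(0,1)$, $\mathbf{k}_{-j}=-\mathbf{k}_j$. The linearisation of the reduced ODE in stripes in index ordering $(1,-1,2,-2)$ is $\mathrm{diag}(L_1,L_2^{\rm sq})+\mathcal{O}(\varepsilon^3)$ with $L_2^{\rm sq}=\varepsilon^2(\lambda'_{\tilde\ell}+A'^2\xi)\,\mathrm{Id}_2$, where $\lambda'_{\tilde\ell}=\alpha'+\rho_\kappa\ell'^2+\mathcal{O}(\varepsilon)\in\mathbb{R}$, $\xi=6k_0+2q_0+8q_{11}$, $q_{11}=\langle Q[E_0,Q_{11}],E_0^*\rangle$, $Q_{11}=-(-2k_c^2D+L)^{-1}Q[E_0,E_0]$. *)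

(* Defs.v *)
From HB Require Import structures.
From mathcomp Require Import all_boot all_order all_algebra.
From mathcomp Require Import complex.
From mathcomp Require Import all_classical all_reals all_analysis.

Set Implicit Arguments.
Unset Strict Implicit.
Unset Printing Implicit Defensive.

Import Order.TTheory GRing.Theory Num.Theory.
Import numFieldNormedType.Exports.

Local Open Scope classical_set_scope.
Local Open Scope ring_scope.
Local Open Scope complex_scope.

Definition dot (R : realType) (u v : 'cV[R]_2) : R := (u^T *m v) 0 0.

Definition diag2 (R : realType) (a b : R) : 'M[R]_2 :=
  \matrix_(i, j) (if i == j then (if i == 0 then a else b) else 0).

Definition cmx (R : realType) (A : 'M[R]_2) : 'M[R[i]]_2 :=
  map_mx (fun x => x%:C) A.

Definition symmetric_bilinear (R : realType)
    (Q : 'cV[R]_2 -> 'cV[R]_2 -> 'cV[R]_2) : Prop :=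
  (forall u v, Q u v = Q v u) /\ (forall u, linear (Q u)).

Definition symmetric_trilinear (R : realType)
    (K : 'cV[R]_2 -> 'cV[R]_2 -> 'cV[R]_2 -> 'cV[R]_2) : Prop :=
  [/\ forall u v w, K u v w = K v u w,
      forall u v w, K u v w = K u w v &
      forall u v, linear (K u v)].

(* The quadratic part is kept outside the record, since it depends on epsilon. *)
Record model (R : realType) := Model {
  d1 : R;
  d2 : R;
  Lmx : 'M[R]_2;
  Mmx : 'M[R]_2;
  kc : R;
  E0 : 'cV[R]_2;
  Es : 'cV[R]_2   (* the adjoint kernel vector E_0^* *)
}.

Definition Dmx (R : realType) (S : model R) : 'M[R]_2 := diag2 (d1 S) (d2 S).

Definition Bmx (R : realType) (c : R) : 'M[R]_2 := diag2 (1 + c) c.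

Definition Lhat (R : realType) (S : model R) (c alphac beta k l : R)
    : 'M[R[i]]_2 :=
  cmx (- (k ^+ 2 + l ^+ 2) *: Dmx S + Lmx S + alphac *: Mmx S)
  + ('i * (k * beta)%:C) *: cmx (Bmx c).

Definition disp (R : realType) (S : model R) (c alphac beta : R)
    (lambda : R[i]) (k l : R) : R[i] :=
  \det (Lhat S c alphac beta k l - lambda%:M).

(* At beta = 0 the matrix Lhat does not involve c, which is set to 0 in
   [turing] and [lambda_M]. The derivative in lambda is a complex derivative. *)
Definition turing (R : realType) (S : model R) : Prop :=
  [/\ forall lambda : R[i], eigenvalue (cmx (Lmx S)) lambda ->
        complex.Re lambda < 0,
      forall (lambda : R[i]) (k l : R),
        (disp S 0 0 0 lambda k l = 0 /\ 0 <= complex.Re lambda) <->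
        (lambda = 0 /\ k ^+ 2 + l ^+ 2 = kc S ^+ 2) &
      forall k l : R, k ^+ 2 + l ^+ 2 = kc S ^+ 2 ->
        derive1 (fun lambda : R[i]^o => disp S 0 0 0 lambda k l : R[i]^o) 0 != 0].

(* At beta = 0, d depends on (k, l) through k^2 + l^2 only, so the critical
   wave vector (kc, 0) is used; there, at lambda = 0, both partial derivatives
   are real. *)
Definition lambda_M (R : realType) (S : model R) : R :=
  - (derive1 (fun a : R => complex.Re (disp S 0 a 0 0 (kc S) 0)) 0
     / complex.Re
         (derive1 (fun lambda : R[i]^o => disp S 0 0 0 lambda (kc S) 0 : R[i]^o) 0)).

Definition Ncrit (R : realType) (S : model R) : 'M[R]_2 :=
  - (kc S) ^+ 2 *: Dmx S + Lmx S.

Definition critical_vectors (R : realType) (S : model R) : Prop :=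
  [/\ forall v : 'cV[R]_2, Ncrit S *m v = 0 <-> exists a : R, v = a *: E0 S,
      forall v : 'cV[R]_2,
        (Ncrit S)^T *m v = 0 <-> exists a : R, v = a *: Es S,
      dot (E0 S) (E0 S) = 1 &
      dot (E0 S) (Es S) = 1].

(* Inverse of -kc^2 D + L from its range to the kernel of the projection
   <., E_0^*> E_0; the value outside the range is irrelevant. *)
Definition Ninv (R : realType) (S : model R) (v : 'cV[R]_2) : 'cV[R]_2 :=
  xget 0 [set w | Ncrit S *m w = v /\ dot w (Es S) *: E0 S = 0].

Definition lambda_beta (R : realType) (S : model R) : R :=
  (Lmx S 1 1 - kc S ^+ 2 * d2 S)
  / (Lmx S 0 0 + Lmx S 1 1 - kc S ^+ 2 * (d1 S + d2 S)).

Definition B0 (R : realType) (S : model R) : 'M[R]_2 := Bmx (- lambda_beta S).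

Definition w_Abeta (R : realType) (S : model R) : 'cV[R]_2 :=
  kc S *: Ninv S (dot (B0 S *m E0 S) (Es S) *: E0 S - B0 S *m E0 S).

Definition w_Akappa (R : realType) (S : model R) : 'cV[R]_2 :=
  (2 * kc S) *: Ninv S (Dmx S *m E0 S).

Definition rho_beta (R : realType) (S : model R) : R :=
  - kc S * dot (B0 S *m w_Abeta S) (Es S).

Definition rho_kappa (R : realType) (S : model R) : R :=
  - 2 * kc S * dot (Dmx S *m w_Akappa S) (Es S).

(* E_0 is real, so its complex conjugate in the coefficients is E_0 itself. *)
Definition Q_0 (R : realType) (S : model R)
    (Q : 'cV[R]_2 -> 'cV[R]_2 -> 'cV[R]_2) : 'cV[R]_2 :=
  - 2 *: (invmx (Lmx S) *m Q (E0 S) (E0 S)).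

Definition Q_2 (R : realType) (S : model R)
    (Q : 'cV[R]_2 -> 'cV[R]_2 -> 'cV[R]_2) : 'cV[R]_2 :=
  - 2 *: (invmx (- 4 * kc S ^+ 2 *: Dmx S + Lmx S) *m Q (E0 S) (E0 S)).

Definition Q_11 (R : realType) (S : model R)
    (Q : 'cV[R]_2 -> 'cV[R]_2 -> 'cV[R]_2) : 'cV[R]_2 :=
  - (invmx (- 2 * kc S ^+ 2 *: Dmx S + Lmx S) *m Q (E0 S) (E0 S)).

Definition q_0 (R : realType) (S : model R)
    (Q : 'cV[R]_2 -> 'cV[R]_2 -> 'cV[R]_2) : R :=
  dot (Q (E0 S) (Q_0 S Q)) (Es S).

Definition q_2 (R : realType) (S : model R)
    (Q : 'cV[R]_2 -> 'cV[R]_2 -> 'cV[R]_2) : R :=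
  dot (Q (E0 S) (Q_2 S Q)) (Es S).

Definition q_11 (R : realType) (S : model R)
    (Q : 'cV[R]_2 -> 'cV[R]_2 -> 'cV[R]_2) : R :=
  dot (Q (E0 S) (Q_11 S Q)) (Es S).

Definition k_0 (R : realType) (S : model R)
    (K : 'cV[R]_2 -> 'cV[R]_2 -> 'cV[R]_2 -> 'cV[R]_2) : R :=
  dot (K (E0 S) (E0 S) (E0 S)) (Es S).

Definition rho_nl (R : realType) (S : model R)
    (Q : 'cV[R]_2 -> 'cV[R]_2 -> 'cV[R]_2)
    (K : 'cV[R]_2 -> 'cV[R]_2 -> 'cV[R]_2 -> 'cV[R]_2) : R :=
  3 * k_0 S K + 2 * q_0 S Q + q_2 S Q.

Definition xi_sq (R : realType) (S : model R)
    (Q : 'cV[R]_2 -> 'cV[R]_2 -> 'cV[R]_2)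
    (K : 'cV[R]_2 -> 'cV[R]_2 -> 'cV[R]_2 -> 'cV[R]_2) : R :=
  6 * k_0 S K + 2 * q_0 S Q + 8 * q_11 S Q.

(* Functions of the form u t x y. The term beta c u_x contained in
   beta B(c) u_x puts the system in the frame moving with velocity beta c, so
   travelling waves of that velocity are its time-independent solutions. *)
Definition solves_system (R : realType) (S : model R) (c alphac beta : R)
    (Q : 'cV[R]_2 -> 'cV[R]_2 -> 'cV[R]_2)
    (K : 'cV[R]_2 -> 'cV[R]_2 -> 'cV[R]_2 -> 'cV[R]_2)
    (u : R -> R -> R -> 'cV[R]_2) : Prop :=
  forall t x y : R,
    let ut := fun s => u s x y in
    let ux := fun s => u t s y in
    let uy := fun s => u t x s in
    [/\ derivable ut t 1,
        derivable ux x 1 /\ derivable (derive1 ux) x 1,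
        derivable uy y 1 /\ derivable (derive1 uy) y 1 &
        derive1 ut t = Dmx S *m (derive1n 2 ux x + derive1n 2 uy y)
                   + Lmx S *m u t x y + alphac *: (Mmx S *m u t x y)
                   + beta *: (Bmx c *m derive1 ux x)
                   + Q (u t x y) (u t x y) + K (u t x y) (u t x y) (u t x y)].

Definition is_stripe (R : realType) (S : model R)
    (c alphac beta kappa ell : R)
    (Q : 'cV[R]_2 -> 'cV[R]_2 -> 'cV[R]_2)
    (K : 'cV[R]_2 -> 'cV[R]_2 -> 'cV[R]_2 -> 'cV[R]_2)
    (phi : R -> 'cV[R]_2) : Prop :=
  let u := fun t x y : R => phi x in
  [/\ solves_system S c alphac beta Q K u,
      forall t x y : R, u t (x + 2 * pi / kappa) y = u t x y
                     /\ u t x (y + 2 * pi / ell) = u t x y &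
      exists x, phi x != 0].

(* A family of stripes indexed by epsilon, in the scaling
   alpha = eps^2 alpha', alphac = alpha / lambda_M, beta = eps beta',
   kappa = kc + eps kappa', ell = kc + eps ell', A = eps A'. The last two
   fields record the leading-order profile and the correspondence of the
   stripe with a positive solution A = eps A' of the bifurcation equation. *)
Record stripes (R : realType) (S : model R)
    (Q : R -> 'cV[R]_2 -> 'cV[R]_2 -> 'cV[R]_2)
    (K : 'cV[R]_2 -> 'cV[R]_2 -> 'cV[R]_2 -> 'cV[R]_2)
    (alpha' beta' kappa' ell' c A' : R -> R)
    (phi : R -> R -> 'cV[R]_2) : Prop := Stripes {
  stripes_velocity :
    (fun e => c e + lambda_beta S : R^o) =O_ (0^'+) (fun e => e : R^o);
  stripes_solution : \forall e \near 0^'+,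
    is_stripe S (c e) (e ^+ 2 * alpha' e / lambda_M S) (e * beta' e)
      (kc S + e * kappa' e) (kc S + e * ell' e) (Q e) K (phi e);
  stripes_amplitude : \forall e \near 0^'+, 0 < A' e;
  stripes_profile : exists x0 : R -> R,
    forall eta : R, 0 < eta -> \forall e \near 0^'+, forall x : R,
      `|phi e x - (2 * e * A' e * cos ((kc S + e * kappa' e) * (x - x0 e)))
                  *: E0 S| <= eta * e;
  stripes_bifurcation : exists2 r : R -> R,
    (r : R -> R^o) =O_ (0^'+) (fun e => e : R^o) &
    \forall e \near 0^'+,
      e ^+ 2 * (alpha' e + rho_beta S * beta' e ^+ 2
                + rho_kappa S * kappa' e ^+ 2
                + rho_nl S (Q e) K * A' e ^+ 2 + r e) = 0
}.

Definition bounded_family (R : realType) (f : R -> R) : Prop :=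
  (f : R -> R^o) =O_ (0^'+) (fun=> 1 : R^o).

Definition bounded_bilinear_family (R : realType)
    (Q : R -> 'cV[R]_2 -> 'cV[R]_2 -> 'cV[R]_2) : Prop :=
  exists C : R, \forall e \near 0^'+, forall u v : 'cV[R]_2,
    `|Q e u v| <= C * `|u| * `|v|.

(* The block, in the coordinates (u_2, u_{-2}), of the linearisation in the
   stripes of the vector field on the centre manifold. *)
Definition L2sq (R : realType) (S : model R)
    (Q : R -> 'cV[R]_2 -> 'cV[R]_2 -> 'cV[R]_2)
    (K : 'cV[R]_2 -> 'cV[R]_2 -> 'cV[R]_2 -> 'cV[R]_2)
    (lambda' A' : R -> R) (e : R) : 'M[R]_2 :=
  (e ^+ 2 * (lambda' e + A' e ^+ 2 * xi_sq S (Q e) K))%:M.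

Definition double_eigenvalue (R : realType) (A : 'M[R]_2) (lambda : R) : Prop :=
  eigenvalue A lambda /\ mup lambda (char_poly A) = 2%N.

(* Main.v *)
(* On the stripe branch the bifurcation equation gives
   rho_nl A'^2 = - (alpha' + rho_beta beta'^2 + rho_kappa kappa'^2) + O(eps).
   The cubic parts of rho_nl and xi are 3 k_0 and 6 k_0, so xi - 2 rho_nl only
   contains terms quadratic in Q = eps Q', and xi A'^2 may be replaced by
   2 rho_nl A'^2 up to O(eps^2). *)
Require Import Defs.
From HB Require Import structures.
From mathcomp Require Import all_boot all_order all_algebra.
From mathcomp Require Import complex.
From mathcomp Require Import all_classical all_reals all_analysis.
From mathcomp Require Import ring.
Import Order.TTheory GRing.Theory Num.Theory.
Import numFieldNormedType.Exports.
Local Open Scope classical_set_scope.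
Local Open Scope ring_scope.


(** The matrix norm is the largest absolute value of an entry, and each entry of the product is a
    sum of [n] products; hence the factor [n]. *)
Lemma norm_mulmx_le {R : realDomainType} {m n p : nat}
    (A : 'M[R]_(m, n)) (B : 'M[R]_(n, p)) :
  `|A *m B| <= n%:R * `|A| * `|B|.
Proof.
have entry (k l : nat) (X : 'M[R]_(k, l)) i j : `|X i j| <= `|X|.
  rewrite [leRHS]mx_normrE.
  exact: (le_bigmax _ (fun ij => `|X ij.1 ij.2|) (i, j)).
rewrite [leLHS]mx_normrE; apply/bigmax_leP; split=> [|[i k] _ /=].
  by rewrite !mulr_ge0 ?normr_ge0.
rewrite mxE (le_trans (ler_norm_sum _ _ _)) //.
apply: (@le_trans _ _ (\sum_(j < n) `|A| * `|B|)).
  by apply: ler_sum => j _; rewrite normrM ler_pM ?normr_ge0.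
by rewrite sumr_const card_ord -mulrA mulr_natl.
Qed.

Lemma dot_le {R : realType} (u v : 'cV[R]_2) : `|dot u v| <= 2 * `|v| * `|u|.
Proof.
(* A 1x1 matrix is its own transpose; the swap puts the fixed vector [v] first in the bound. *)
have -> : dot u v = (v^T *m u) 0 0.
  by rewrite /dot -[v in LHS]trmxK -trmx_mul mxE.
have tr_le : `|v^T| <= `|v|.
  rewrite [leLHS]mx_normrE; apply/bigmax_leP; split=> [|[i j] _ /=] //.
  rewrite mxE [leRHS]mx_normrE.
  exact: (le_bigmax _ (fun ij => `|v ij.1 ij.2|) (j, i)).
apply: (@le_trans _ _ `|v^T *m u|).
  rewrite [leRHS]mx_normrE.
  exact: (le_bigmax _ (fun ij => `|(v^T *m u) ij.1 ij.2|) (0, 0)).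
by rewrite (le_trans (norm_mulmx_le _ _)) // ler_wpM2r ?ler_wpM2l.
Qed.

Lemma dotDl {R : realType} (u v w : 'cV[R]_2) :
  dot (u + v) w = dot u w + dot v w.
Proof. by rewrite /dot linearD mulmxDl mxE. Qed.

Lemma dotZl {R : realType} (a : R) (u w : 'cV[R]_2) :
  dot (a *: u) w = a * dot u w.
Proof. by rewrite /dot linearZ -scalemxAl mxE. Qed.

Lemma dotNl {R : realType} (u w : 'cV[R]_2) : dot (- u) w = - dot u w.
Proof. by rewrite -scaleN1r dotZl mulN1r. Qed.

(** Common form of [q_0], [q_2] and [q_11]: they arise for [P] equal to -2, -2 and -1 times the
    inverses of L, -4 kc^2 D + L and -2 kc^2 D + L. *)
Definition quadratic_coef {R : realType} (S : model R)
    (Q : 'cV[R]_2 -> 'cV[R]_2 -> 'cV[R]_2) (P : 'M[R]_2) : R :=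
  dot (Q (E0 S) (P *m Q (E0 S) (E0 S))) (Es S).

(** [Q] occurs twice, nested, so one factor [e] comes from the outer occurrence and one, by
    linearity in the second argument, from the inner. *)
Lemma quadratic_coef_scale {R : realType} (S : model R)
    (Q : 'cV[R]_2 -> 'cV[R]_2 -> 'cV[R]_2) (P : 'M[R]_2) (e : R) :
  (forall u, linear (Q u)) ->
  quadratic_coef S (fun u v => e *: Q u v) P = e ^+ 2 * quadratic_coef S Q P.
Proof.
move=> Qlin; rewrite /quadratic_coef -scalemxAr dotZl.
have -> a v : Q (E0 S) (a *: v) = a *: Q (E0 S) v.
  exact: (scalable_linear (Qlin (E0 S))).
by rewrite dotZl mulrA expr2.
Qed.

Lemma quadratic_coef_bounded {R : realType} (S : model R)
    {Q : R -> 'cV[R]_2 -> 'cV[R]_2 -> 'cV[R]_2} (P : 'M[R]_2) :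
  bounded_bilinear_family Q ->
  exists C : R, \forall e \near 0^'+, `|quadratic_coef S (Q e) P| <= C.
Proof.
move=> [C QC].
(* From outside in: the pairing with [Es], the outer [Q], the matrix [P], the inner [Q]. The sign of
   [C] is unknown, hence its absolute value. *)
exists (2 * `|Es S| * (`|C| * `|E0 S| *
         (2 * `|P| * (`|C| * `|E0 S| * `|E0 S|)))).
apply: filterS QC => e QC.
have {}QC u v : `|Q e u v| <= `|C| * `|u| * `|v|.
  by rewrite (le_trans (QC u v)) // !ler_wpM2r // ler_norm.
rewrite (le_trans (dot_le _ _)) // ler_wpM2l ?mulr_ge0 //.
rewrite (le_trans (QC _ _)) // ler_wpM2l ?mulr_ge0 //.
by rewrite (le_trans (norm_mulmx_le _ _)) // ler_wpM2l ?mulr_ge0.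
Qed.

(** The terms in [k_0] cancel, leaving -2 q_0 - 2 q_2 + 8 q_11. As [P] is chosen before [Q], one
    matrix serves all values of epsilon. *)
Lemma xi_sq_sub_rho_nl {R : realType} (S : model R)
    (K : 'cV[R]_2 -> 'cV[R]_2 -> 'cV[R]_2 -> 'cV[R]_2) :
  exists P : 'M[R]_2, forall Q : 'cV[R]_2 -> 'cV[R]_2 -> 'cV[R]_2,
    (forall u, linear (Q u)) ->
    xi_sq S Q K - 2 * rho_nl S Q K = quadratic_coef S Q P.
Proof.
exists (4 *: invmx (Lmx S) + 4 *: invmx (- 4 * kc S ^+ 2 *: Dmx S + Lmx S)
        - 8 *: invmx (- 2 * kc S ^+ 2 *: Dmx S + Lmx S)) => Q Qlin.
rewrite /xi_sq /rho_nl /quadratic_coef.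
have QD u v : Q (E0 S) (u + v) = Q (E0 S) u + Q (E0 S) v.
  by have := Qlin (E0 S) 1 u v; rewrite !scale1r.
have QZ a v : Q (E0 S) (a *: v) = a *: Q (E0 S) v.
  exact: (scalable_linear (Qlin (E0 S))).
have QN v : Q (E0 S) (- v) = - Q (E0 S) v by rewrite -scaleN1r QZ scaleN1r.
rewrite !mulmxDl mulNmx -!scalemxAl !QD QN !QZ !dotDl dotNl !dotZl.
rewrite /q_0 /q_2 /q_11 /Q_0 /Q_2 /Q_11 QN !QZ dotNl !dotZl.
ring.
Qed.

Lemma double_eigenvalue_scalar (R : realType) (a : R) :
  double_eigenvalue a%:M a.
Proof.
have charE : char_poly (a%:M : 'M[R]_2) = ('X - a%:P) ^+ 2.
  rewrite char_poly_trig ?scalar_mx_is_trig // expr2.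
  by rewrite big_ord_recl big_ord1 !mxE !eqxx !mulr1n.
split; last by rewrite charE mup_XsubCX eqxx.
by rewrite eigenvalue_root_char charE rootE !hornerE subrr expr0n.
Qed.

Theorem corollary3p9 (R : realType) (S : model R)
    (Q' : R -> 'cV[R]_2 -> 'cV[R]_2 -> 'cV[R]_2)
    (K : 'cV[R]_2 -> 'cV[R]_2 -> 'cV[R]_2 -> 'cV[R]_2)
    (alpha' beta' kappa' ell' A' lambda' c : R -> R)
    (phi : R -> R -> 'cV[R]_2) :
  let Q := fun (e : R) (u v : 'cV[R]_2) => e *: Q' e u v in
  0 < d1 S -> 0 < d2 S -> 0 < kc S ->
  turing S -> critical_vectors S -> lambda_M S != 0 ->
  (forall e : R, symmetric_bilinear (Q' e)) ->
  symmetric_trilinear K ->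
  bounded_bilinear_family Q' ->
  (\forall e \near 0^'+, rho_nl S (Q e) K < 0) ->
  bounded_family alpha' -> bounded_family beta' -> bounded_family kappa' ->
  bounded_family ell' -> bounded_family A' ->
  stripes S Q K alpha' beta' kappa' ell' c A' phi ->
  (fun e : R => lambda' e - (alpha' e + rho_kappa S * ell' e ^+ 2) : R^o)
    =O_ (0^'+) (fun e : R => e : R^o) ->
  exists lambda_sq : R -> R,
    (forall e : R, double_eigenvalue (L2sq S Q K lambda' A' e) (lambda_sq e)) /\
    (fun e : R =>
       lambda_sq e
       - e ^+ 2 * (- alpha' e - 2 * rho_beta S * beta' e ^+ 2
                   + rho_kappa S * (ell' e ^+ 2 - 2 * kappa' e ^+ 2)) : R^o)
      =o_ (0^'+) (fun e : R => e ^+ 2 : R^o).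
Proof.
move=> Q _ _ _ _ _ _ Qsym _ Qbd _ _ _ _ _ A'bd [_ _ _ _ [r rO bif]] lamO.
exists (fun e => e ^+ 2 * (lambda' e + A' e ^+ 2 * xi_sq S (Q e) K)); split.
  by move=> e; exact: double_eigenvalue_scalar.
have [P xiP] := xi_sq_sub_rho_nl S K.
have [C QC] := quadratic_coef_bounded S P Qbd.
have /eqO_exP[Ca Ca0 aO] := A'bd.
have /eqO_exP[Cr Cr0 {}rO] := rO.
have /eqO_exP[Cl Cl0 {}lamO] := lamO.
(* The error will be e^2 times a sum of three terms, bounded by these three constants times [e]. *)
pose N := Cl + Ca ^+ 2 * `|C| + 2 * Cr.
have N0 : 0 < N by rewrite /N !ltr_wpDr ?mulr_ge0 ?exprn_ge0 // ltW.
apply/eqoP => eta eta0.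
near=> e.
have e0 : 0 < e by near: e; exact: nbhs_right_gt.
have e1 : e <= 1 by near: e; exact: nbhs_right_le.
have eN : e <= eta / N by near: e; apply: nbhs_right_le; rewrite divr_gt0.
have bif_e : alpha' e + rho_beta S * beta' e ^+ 2
    + rho_kappa S * kappa' e ^+ 2 + rho_nl S (Q e) K * A' e ^+ 2 + r e = 0.
  have : e ^+ 2 * (alpha' e + rho_beta S * beta' e ^+ 2
    + rho_kappa S * kappa' e ^+ 2 + rho_nl S (Q e) K * A' e ^+ 2 + r e) = 0.
    by near: e.
  by move/eqP; rewrite mulf_eq0 expf_eq0 gt_eqF //= => /eqP.
have xiE : xi_sq S (Q e) K
    = 2 * rho_nl S (Q e) K + e ^+ 2 * quadratic_coef S (Q' e) P.
  have [_ Qlin] := Qsym e.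
  (* The scaled form e *: Q' e is [Q e] by definition; only its linearity is left to check. *)
  rewrite -quadratic_coef_scale // -xiP ?subrKC // => u a v w.
  by rewrite /Q Qlin scalerDr !scalerA mulrC.
set s := lambda' e - (alpha' e + rho_kappa S * ell' e ^+ 2).
set q := quadratic_coef S (Q' e) P in xiE.
have -> : e ^+ 2 * (lambda' e + A' e ^+ 2 * xi_sq S (Q e) K)
    - e ^+ 2 * (- alpha' e - 2 * rho_beta S * beta' e ^+ 2
                + rho_kappa S * (ell' e ^+ 2 - 2 * kappa' e ^+ 2))
    = e ^+ 2 * (s + e ^+ 2 * (A' e ^+ 2 * q) - 2 * r e).
  (* The two sides differ by 2 e^2 times the left side of [bif_e], which vanishes. *)
  apply/eqP; rewrite -subr_eq0 xiE /s; apply/eqP.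
  rewrite -[RHS](mulr0 (2 * e ^+ 2)) -bif_e; ring.
have sle : `|s| <= Cl * e by rewrite /s -[in leRHS](gtr0_norm e0); near: e.
have rle : `|r e| <= Cr * e by rewrite -[in leRHS](gtr0_norm e0); near: e.
have ale : `|A' e| <= Ca.
  by rewrite -[leRHS]mulr1 -[in leRHS](normr1 R); near: e.
have qle : `|q| <= `|C|.
  by rewrite /q (@le_trans _ _ C) ?ler_norm //; near: e.
have aqle : `|e ^+ 2 * (A' e ^+ 2 * q)| <= (Ca ^+ 2 * `|C|) * e.
  rewrite normrM mulrC (gtr0_norm (exprn_gt0 2 e0)) ler_pM ?sqr_ge0 //.
    by rewrite normrM normrX ler_pM ?sqr_ge0 // lerXn2r // nnegrE ltW.
  (* Here e <= 1 lowers the order e^2 to the common order [e]. *)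
  by rewrite expr2 ler_piMl // ltW.
rewrite normrM mulrC ler_wpM2r //.
(* With e <= eta / N, the bound N e on the bracket is at most [eta], as the little-o requires. *)
apply: (@le_trans _ _ (N * e)); last by rewrite mulrC -ler_pdivlMr.
have -> : N * e = Cl * e + (Ca ^+ 2 * `|C|) * e + 2 * (Cr * e).
  by rewrite /N; ring.
rewrite (le_trans (ler_normB _ _)) // lerD //.
  by rewrite (le_trans (ler_normD _ _)) // lerD.
by rewrite normrM ger0_norm // ler_pM2l.
Unshelve. all: by end_near.
Qed.
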